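(* Suppose that $A$ is a weak* closed unital subalgebra of a von Neumann algebra $M$. Suppose that $\Phi:A\to D$ is a unital weak* continuous contractive linear map into a von Neumann algebra $D$. If $A$ has the property that for every weak* continuous state $\varphi$ on $D$, the functional $\varphi\circ\Phi$ has a unique normal state extension to $M$, then $\Phi$ has a unique normal positive extension $\Psi:M\to D$.
   Context: A unital subalgebra of $M$ is one containing $1_M$. ''Normal'' means weak* continuous. *)

(* Defs.v *)
From HB Require Import structures.
From mathcomp Require Import all_boot all_order all_algebra.
From mathcomp Require Import complex.
From mathcomp Require Import all_classical all_reals all_analysis.

Set Implicit Arguments.
Unset Strict Implicit.
Unset Printing Implicit Defensive.

Import Order.TTheory GRing.Theory Num.Theory.
Import numFieldNormedType.Exports.

Local Open Scope classical_set_scope.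
Local Open Scope ring_scope.

(* Complex Hilbert spaces, of any dimension (0 included).  The inner product is
   linear in its first argument.  The norm of a [normedModType R[i]] takes its
   values in [R[i]], where [0 <= z] means that z is real and nonnegative. *)
Record hilbertSpace (R : realType) := HilbertSpace {
  hilbert_sort :> completeNormedModType R[i] ;
  inner : {dot hilbert_sort for Num.conj} ;
  innerE : forall x : hilbert_sort, inner x x = `|x| ^+ 2 }.

Section BoundedOperators.
Context {R : realType} (H : hilbertSpace R).

Definition bounded_operator : {pred H -> H} :=
  fun f => `[< linear f /\ continuous f >].

Lemma bounded_operatorP (f : H -> H) :
  reflect (linear f /\ continuous f) (f \in bounded_operator).
Proof. exact: asboolP. Qed.

Lemma bounded_operator_submod : submod_closed bounded_operator.
Proof.
split.
  apply/bounded_operatorP; split; last by move=> x; exact: cvg_cst.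
  by move=> a x y; rewrite [RHS]addr0 scaler0.
move=> a S T /bounded_operatorP[lS cS] /bounded_operatorP[lT cT].
apply/bounded_operatorP; split.
  move=> b x y; rewrite -[LHS]/(a *: S _ + T _) -[RHS]/(b *: (a *: S x + T x) + _).
  by rewrite lS lT !scalerDr !scalerA mulrC addrACA.
by move=> x; apply: cvgD; [apply: cvgZl_tmp; exact: cS|exact: cT].
Qed.

HB.instance Definition _ :=
  GRing.isSubmodClosed.Build R[i] (H -> H) bounded_operator
    bounded_operator_submod.

(* B(H) *)
Record bop := Bop {
  bop_fun :> H -> H ;
  bop_subproof : bop_fun \in bounded_operator }.

HB.instance Definition _ := [isSub for bop_fun].
HB.instance Definition _ := [Choice of bop by <:].
HB.instance Definition _ := [SubChoice_isSubLmodule of bop by <:].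

Lemma bop_linear (T : bop) : linear T.
Proof. by have /bounded_operatorP[] := bop_subproof T. Qed.

Lemma bop_continuous (T : bop) : continuous T.
Proof. by have /bounded_operatorP[] := bop_subproof T. Qed.

Fact bop_one_subproof : (idfun : H -> H) \in bounded_operator.
Proof. by apply/bounded_operatorP; split=> // x; exact: cvg_id. Qed.

Definition bop_one : bop := Bop bop_one_subproof.

Fact bop_mul_subproof (S T : bop) : (S \o T : H -> H) \in bounded_operator.
Proof.
apply/bounded_operatorP; split; first by move=> a x y /=; rewrite !bop_linear.
by move=> x; apply: continuous_comp; exact: bop_continuous.
Qed.

Definition bop_mul (S T : bop) : bop := Bop (bop_mul_subproof S T).

Fact bop_mulA : associative bop_mul.
Proof. by move=> S T U; exact/val_inj. Qed.

Fact bop_mul1l : left_id bop_one bop_mul.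
Proof. by move=> T; apply/val_inj. Qed.

Fact bop_mul1r : right_id bop_one bop_mul.
Proof. by move=> T; apply/val_inj. Qed.

Fact bop_mulDl : left_distributive bop_mul +%R.
Proof. by move=> S T U; apply/val_inj. Qed.

Fact bop_mulDr : right_distributive bop_mul +%R.
Proof.
move=> S T U; apply/val_inj/funext => x /=.
by have := bop_linear S 1 (T x) (U x); rewrite !scale1r.
Qed.

HB.instance Definition _ := GRing.Zmodule_isPzRing.Build bop
  bop_mulA bop_mul1l bop_mul1r bop_mulDl bop_mulDr.

Definition opnorm (T : bop) : R :=
  sup [set complex.Re `|T x| | x in [set x : H | `|x| <= 1]].

Definition is_adjoint (T S : bop) :=
  forall x y : H, inner H (T x) y = inner H x (S y).

Definition positive_bop (T : bop) := forall x : H, 0 <= inner H (T x) x.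

Record l2seq := L2seq {
  l2fun :> nat -> H ;
  l2P : cvgn (series (fun n => `|l2fun n| ^+ 2) : nat -> R[i]^o) }.

(* The weak* topology of B(H), seen as the dual of the trace class operators:
   the coarsest topology for which all the functionals
   T |-> \sum_n <T xi_n, eta_n>, with \sum_n |xi_n|^2 and \sum_n |eta_n|^2
   finite, are continuous. *)
Definition sigma_weak (T : bop) : {ptws l2seq * l2seq -> R[i]^o} :=
  fun p => limn (series (fun n => inner H (T (p.1 n)) (p.2 n)) : nat -> R[i]^o).

HB.instance Definition _ := Topological.copy bop (initial_topology sigma_weak).

Definition commutant (M : set bop) : set bop :=
  [set T | forall S, M S -> T * S = S * T].

Record vonNeumann_algebra (M : set bop) : Prop := {
  vN_adjoint : forall T, M T -> exists2 S, M S & is_adjoint T S ;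
  vN_bicommutant : commutant (commutant M) = M }.

Record unital_subalgebra (A : set bop) : Prop := {
  subalgebra1 : A 1 ;
  subalgebra_lin : forall (a : R[i]) S T, A S -> A T -> A (a *: S + T) ;
  subalgebraM : forall S T : bop, A S -> A T -> A (S * T) }.

End BoundedOperators.

(* Maps on a linear subspace E of B(H) are given by total functions, of which
   only the values on E matter.  E carries the topology induced by the weak*
   topology of B(H); on a weak* closed E this is the weak* topology of E. *)

Definition linear_on {R : realType} {H : hilbertSpace R} {V : lmodType R[i]}
    (E : set (bop H)) (f : bop H -> V) :=
  forall (a : R[i]) (S T : bop H), E S -> E T ->
    f (a *: S + T) = a *: f S + f T.

Definition normal_on {R : realType} {H : hilbertSpace R} {V : topologicalType}
    (E : set (bop H)) (f : bop H -> V) := {within E, continuous f}.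

Definition contractive_on {R : realType} {H K : hilbertSpace R}
    (E : set (bop H)) (f : bop H -> bop K) :=
  forall T, E T -> opnorm (f T) <= opnorm T.

Record normal_state {R : realType} {H : hilbertSpace R} (M : set (bop H))
    (phi : bop H -> R[i]^o) : Prop := {
  state_linear : linear_on M phi ;
  state_normal : normal_on M phi ;
  state_positive : forall T, M T -> positive_bop T -> 0 <= phi T :> R[i] ;
  state1 : phi 1 = 1 }.

Record normal_positive_map {R : realType} {H K : hilbertSpace R}
    (M : set (bop H)) (D : set (bop K)) (Psi : bop H -> bop K) : Prop := {
  map_fun : set_fun M D Psi ;
  map_linear : linear_on M Psi ;
  map_normal : normal_on M Psi ;
  map_positive : forall T, M T -> positive_bop T -> positive_bop (Psi T) }.

Definition exists_unique_on {T V : Type} (M : set T) (P : (T -> V) -> Prop) :=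
  exists2 f, P f & forall g, P g -> {in M, g =1 f}.

(* Main.v *)
(* Call a pair (p, g) of positive normal functionals, on D and on M, related
   when g extends p o Phi.  By hypothesis every p is related to exactly one g,
   so p |-> g is additive and homogeneous, and it extends to a linear map from
   the linear combinations of positive normal functionals on D to normal
   functionals on M (a predual map).  Applied to the functionals
   S |-> <S x, y> on D it gives, for each T in M, a bounded sesquilinear form
   in (x, y), hence an operator Psi T by Riesz; it lies in D = D'' because
   S |-> <S U x, y> and S |-> <S x, U^* y> agree on D for every U in D'.
   Normality of Psi amounts to countable additivity of p |-> g along the sums
   \sum_n <S u_n, u_n>, which follows from finite additivity since the tails
   of such a sum are themselves positive normal functionals.
   Conversely, any normal positive extension of Phi pulls each
   <S x, x> back to the functional related to it, which gives uniqueness. *)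

From HB Require Import structures.
Require Import Defs.
From mathcomp Require Import all_boot all_order all_algebra.
From mathcomp Require Import complex ring lra.
From mathcomp Require Import all_classical all_reals all_analysis.

Set Implicit Arguments.
Unset Strict Implicit.
Unset Printing Implicit Defensive.

Import Order.TTheory GRing.Theory Num.Theory.
Import numFieldNormedType.Exports.

Local Open Scope classical_set_scope.
Local Open Scope ring_scope.

(** * Complex sequences and series *)

Section ComplexSequences.
Context {R : realType}.
Implicit Types (z : R[i]) (u : nat -> R[i]^o).

Lemma ReD z1 z2 : complex.Re (z1 + z2) = complex.Re z1 + complex.Re z2.
Proof. by case: z1 z2 => [a b] [c d]. Qed.

Lemma ImD z1 z2 : complex.Im (z1 + z2) = complex.Im z1 + complex.Im z2.
Proof. by case: z1 z2 => [a b] [c d]. Qed.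

Lemma ReB z1 z2 : complex.Re (z1 - z2) = complex.Re z1 - complex.Re z2.
Proof. by case: z1 z2 => [a b] [c d]. Qed.

Lemma ImB z1 z2 : complex.Im (z1 - z2) = complex.Im z1 - complex.Im z2.
Proof. by case: z1 z2 => [a b] [c d]. Qed.

Lemma Re_sum u n : complex.Re (\sum_(0 <= k < n) u k) =
  \sum_(0 <= k < n) complex.Re (u k).
Proof. exact: (big_morph (@complex.Re R) ReD). Qed.

Lemma Im_sum u n : complex.Im (\sum_(0 <= k < n) u k) =
  \sum_(0 <= k < n) complex.Im (u k).
Proof. exact: (big_morph (@complex.Im R) ImD). Qed.

Lemma normcE_Re z : `|z| = real_complex R (complex.Re `|z|).
Proof. by rewrite normc_def. Qed.

Lemma ge0_realE z : 0 <= z -> z = real_complex R (complex.Re z).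
Proof. by move=> z0; rewrite RRe_real// ger0_real. Qed.

Lemma normr_Re_le z : `|complex.Re z| <= complex.Re `|z|.
Proof.
rewrite normc_def /= -(sqrtr_sqr (complex.Re z)); apply: ler_wsqrtr.
by rewrite lerDl sqr_ge0.
Qed.

Lemma normr_Im_le z : `|complex.Im z| <= complex.Re `|z|.
Proof.
rewrite normc_def /= -(sqrtr_sqr (complex.Im z)); apply: ler_wsqrtr.
by rewrite lerDr sqr_ge0.
Qed.

Lemma normc_le_ReIm z :
  `|z| <= real_complex R (`|complex.Re z| + `|complex.Im z|).
Proof.
set s := `|complex.Re z| + _; have s0 : 0 <= s by rewrite addr_ge0.
rewrite normc_def lecR -(ger0_norm s0) -(sqrtr_sqr s).
apply: ler_wsqrtr; rewrite /s sqrrD !real_normK ?num_real//.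
by rewrite lerD2r lerDl mulrn_wge0// mulr_ge0.
Qed.

Lemma cvg_Re u (l : R[i]^o) : u @ \oo --> l ->
  (fun n => complex.Re (u n)) @ \oo --> complex.Re l.
Proof.
move=> /cvgrPdist_lt ul; apply/cvgrPdist_lt => e e0.
have e0' : 0 < (real_complex R e : R[i]) by rewrite ltcR.
apply: filterS (ul _ e0') => n; rewrite normcE_Re ltcR.
by apply: le_lt_trans; rewrite -ReB normr_Re_le.
Qed.

Lemma cvg_Im u (l : R[i]^o) : u @ \oo --> l ->
  (fun n => complex.Im (u n)) @ \oo --> complex.Im l.
Proof.
move=> /cvgrPdist_lt ul; apply/cvgrPdist_lt => e e0.
have e0' : 0 < (real_complex R e : R[i]) by rewrite ltcR.
apply: filterS (ul _ e0') => n; rewrite normcE_Re ltcR.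
by apply: le_lt_trans; rewrite -ImB normr_Im_le.
Qed.

Lemma cvg_complex u (l : R[i]^o) :
  (fun n => complex.Re (u n)) @ \oo --> complex.Re l ->
  (fun n => complex.Im (u n)) @ \oo --> complex.Im l -> u @ \oo --> l.
Proof.
move=> /cvgrPdist_lt ul /cvgrPdist_lt vl; apply/cvgrPdist_lt => e e0.
have : 0 <= e by apply: ltW.
move=> /ge0_realE ee; move: e0; rewrite ee ltcR => e0.
near=> n; apply: le_lt_trans (normc_le_ReIm _) _.
rewrite ltcR [ltRHS]splitr ltrD//.
  by rewrite ReB; near: n; apply: ul; rewrite divr_gt0.
by rewrite ImB; near: n; apply: vl; rewrite divr_gt0.
Unshelve. all: by end_near. Qed.

(** Real and imaginary parts are bounded by the modulus, so each of the two real series converges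
    absolutely by comparison with the real parts of [v]. *)
Lemma is_cvg_series_dominated u (v : nat -> R[i]^o) :
  (forall n, `|u n| <= (v n : R[i])) -> cvgn (series v) -> cvgn (series u).
Proof.
move=> uv /cvg_Re; set l := complex.Re _ => vl.
have {}vl : cvgn (series (fun n => complex.Re (v n))).
  apply/cvg_ex; exists l; apply: cvg_trans vl; apply: near_eq_cvg.
  by apply: nearW => n; rewrite /series /= Re_sum.
have uv' n : complex.Re `|u n| <= complex.Re (v n).
  by have := uv n; rewrite lecE => /andP[].
have cv (f : nat -> R) : (forall n, `|f n| <= complex.Re `|u n|) ->
    cvgn (series f).
  move=> fu; apply: normed_cvg; apply: series_le_cvg vl => n //=.
    by apply: le_trans (uv' n); exact: le_trans (fu n).
  exact: le_trans (fu n) (uv' n).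
have /cvg_ex[/= a ua] := cv _ (fun n => normr_Re_le (u n)).
have /cvg_ex[/= b ub] := cv _ (fun n => normr_Im_le (u n)).
apply/cvg_ex; exists (Complex a b); apply: cvg_complex.
  apply: cvg_trans ua; apply: near_eq_cvg.
  by apply: nearW => n; rewrite /series /= Re_sum.
apply: cvg_trans ub; apply: near_eq_cvg.
by apply: nearW => n; rewrite /series /= Im_sum.
Qed.

(** Comparable elements of [R[i]] have equal imaginary parts, so the imaginary part of [u] is
    eventually constant and only the real parts need a limit of inequalities. *)
Lemma limn_ge u (l : R[i]^o) z : u @ \oo --> l -> (\forall n \near \oo,
  z <= u n) ->
  z <= l.
Proof.
move=> ul zu; rewrite lecE; apply/andP; split.
  apply/eqP; apply: (cvg_unique (@Rhausdorff R) (cvg_Im ul)).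
  apply: cvg_near_cst.
  by apply: filterS zu => n; rewrite lecE => /andP[/eqP].
apply: (cvgr_to_ge (cvg_Re ul)).
by apply: filterS zu => n; rewrite lecE => /andP[].
Qed.

End ComplexSequences.

(** * Hilbert spaces *)

Section HilbertSpace.
Context {R : realType} {H : hilbertSpace R}.
Implicit Types (x y z : H) (T S : bop H) (a : R[i]).
Local Notation "''[' x , y ]" := (inner H x y).
Local Notation i := ('i%C : R[i]).
Local Notation toC := (real_complex R).

Lemma innerC x y : '[x, y] = ('[y, x])^*%C.
Proof. by rewrite hermC /= expr0 mul1r. Qed.

Lemma innerDl x y z : '[x + y, z] = '[x, z] + '[y, z].
Proof. exact: linearDl. Qed.

Lemma innerDr x y z : '[x, y + z] = '[x, y] + '[x, z].
Proof. exact: linearDr. Qed.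

Lemma innerBl x y z : '[x - y, z] = '[x, z] - '[y, z].
Proof. exact: linearBl. Qed.

Lemma innerNl x y : '[- x, y] = - '[x, y].
Proof. exact: linearNl. Qed.

Lemma innerNr x y : '[x, - y] = - '[x, y].
Proof. exact: linearNr. Qed.

Lemma innerZl a x y : '[a *: x, y] = a * '[x, y].
Proof. exact: linearZl_LR. Qed.

Lemma innerZr a x y : '[x, a *: y] = (a^*)%C * '[x, y].
Proof. exact: linearZr_LR. Qed.

Definition innerL := (innerNl, innerNr, innerDl, innerDr, innerZl, innerZr).

Lemma inner_ge0 x : 0 <= '[x, x].
Proof. by rewrite innerE exprn_ge0. Qed.

Lemma inner_eq0 x : '[x, x] = 0 -> x = 0.
Proof. by rewrite innerE => /eqP; rewrite sqrf_eq0 normr_eq0 => /eqP. Qed.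

Lemma inner_inj x y : (forall z, '[x, z] = '[y, z]) -> x = y.
Proof.
move=> xy; apply/eqP; rewrite -subr_eq0; apply/eqP/inner_eq0.
by rewrite innerBl xy subrr.
Qed.

Lemma conjc_i : (i^*)%C = - i.
Proof. by apply/eqP; rewrite eq_complex /= oppr0 !eqxx. Qed.

(** ['[y, y] *: x - '[x, y] *: y] is a multiple of the component of [x] orthogonal to [y]; its
    square length is ['[y, y]] times the gap between the squared sides. *)
Lemma cauchy_schwarz x y : `|'[x, y]| <= `|x| * `|y|.
Proof.
have [->|y0] := eqVneq y 0; first by rewrite linear0r !normr0 mulr0.
rewrite -ler_sqr ?nnegrE ?mulr_ge0// exprMn -!innerE.
have b0 : 0 < '[y, y] by rewrite innerE exprn_gt0// normr_gt0.
rewrite -subr_ge0 -(pmulr_rge0 _ b0).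
suff <- : '['[y, y] *: x - '[x, y] *: y, '[y, y] *: x - '[x, y] *: y] =
  '[y, y] * ('[x, x] * '[y, y] - `|'[x, y]| ^+ 2) by exact: inner_ge0.
rewrite normCK -[Num.conj _]/('[x, y]^*)%C !innerL -(innerC y y) -(innerC y x).
ring.
Qed.

Lemma bopD T x y : T (x + y) = T x + T y.
Proof. by have := bop_linear T 1 x y; rewrite !scale1r. Qed.

Lemma bop0 T : T 0 = 0.
Proof. by apply: (addrI (T 0)); rewrite -bopD !addr0. Qed.

Lemma bopZ T a x : T (a *: x) = a *: T x.
Proof. by have := bop_linear T a x 0; rewrite bop0 !addr0. Qed.

Lemma bopN T x : T (- x) = - T x.
Proof. by rewrite -scaleN1r bopZ scaleN1r. Qed.

Definition bopE := (bopN, bopD, bopZ).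

Lemma inner_polar T x y : '[T x, y] = 4^-1 * ('[T (x + y), x + y]
  - '[T (x - y), x - y] + i * '[T (x + i *: y), x + i *: y]
  - i * '[T (x - i *: y), x - i *: y]).
Proof.
rewrite !bopE !innerL conjc_i.
(* [i] becomes a variable [j] with [j ^+ 2 = -1], on which [ring] works formally; the coefficient
   [2 + 2 * j ^+ 2] of ['[T y, x]] is then 0. *)
have := sqr_i R; move: i => j j2.
apply: (@mulfI _ 4); first by rewrite pnatr_eq0.
rewrite [RHS]mulrA mulfV ?pnatr_eq0// mul1r.
transitivity ((2 - 2 * (j ^+ 2)) * '[T x, y] + (2 + 2 * (j ^+ 2)) * '[T y, x]);
  last by ring.
by rewrite j2; ring.
Qed.

(** Over complex scalars polarization recovers an operator from its quadratic form, so identities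
    can be tested on the diagonal. *)
Lemma bop_inj T S : (forall x, '[T x, x] = '[S x, x]) -> T = S.
Proof.
move=> TS; apply/val_inj/funext => x; apply: inner_inj => y.
by rewrite /= !(inner_polar _ x y) !TS.
Qed.

Lemma bop_bounded T : exists c : R, 0 <= c /\ forall x, `|T x| <= toC c * `|x|.
Proof.
pose L := GRing.isLinear.Build _ _ _ _ T (bop_linear T).
pose f : {linear H -> H} := HB.pack (bop_fun T) L.
have /linear_boundedP : bounded_near f (nbhs 0).
  by apply/linear_bounded_continuous; exact: (@bop_continuous _ _ T).
move=> /pinfty_ex_gt0[c c0 fc]; exists (complex.Re c).
have cE := ge0_realE (ltW c0).
split; first by rewrite -lecR -cE ltW.
by move=> x; rewrite -cE; exact: fc.
Qed.

End HilbertSpace.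

Lemma bounded_continuous (R : realType) (V W : normedModType R[i])
    (f : V -> W) (c : R) : (forall x y, f (x - y) = f x - f y) ->
  (forall x, `|f x| <= real_complex R c * `|x|) -> continuous f.
Proof.
move=> fB fc x; apply/cvgrPdist_lt => e e0.
have c0 : 0 < real_complex R (`|c| + 1) by rewrite ltcR ltr_wpDl.
near=> y; rewrite -fB; apply: le_lt_trans (fc _) _.
apply: (@le_lt_trans _ _ (real_complex R (`|c| + 1) * `|x - y|)).
  by rewrite ler_wpM2r// lecR (le_trans (ler_norm _))// lerDl.
rewrite -ltr_pdivlMl//; near: y; apply: cvgr_dist_lt => //.
by rewrite mulr_gt0// invr_gt0.
Unshelve. all: by end_near. Qed.

(** * Riesz representation and bounded sesquilinear forms *)

Section Riesz.
Context {R : realType} {H : hilbertSpace R}.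
Implicit Types (x y z : H) (a : R[i]).
Local Notation "''[' x , y ]" := (inner H x y).
Local Notation i := ('i%C : R[i]).
Local Notation toC := (real_complex R).
Local Notation Re := (@complex.Re R).

Lemma ReZ (r : R) a : Re (toC r * a) = r * Re a.
Proof. by case: a => [b d] /=; rewrite mul0r subr0. Qed.

Lemma normhE x : `|x| = toC (Re `|x|).
Proof. exact: ge0_realE. Qed.

Lemma Re_conjc a : Re (a^*)%C = Re a.
Proof. by case: a. Qed.

Lemma Re_inner_ge0 x : 0 <= Re '[x, x].
Proof. by have := inner_ge0 x; rewrite lecE => /andP[]. Qed.

(* The representing vector is the minimiser of [|x|^2 - 2 Re (f x)]; a
   minimising sequence is Cauchy by the parallelogram law. *)
Lemma riesz (f : H -> R[i]) (c : R) :
  (forall a x y, f (a *: x + y) = a * f x + f y) ->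
  (forall x, `|f x| <= toC c * `|x|) ->
  exists v, forall x, f x = '[x, v].
Proof.
move=> f_lin f_bnd.
have fD x y : f (x + y) = f x + f y by rewrite -(scale1r x) f_lin mul1r scale1r.
have f0 : f 0 = 0 by apply: (addrI (f 0)); rewrite -fD !addr0.
have fZ a x : f (a *: x) = a * f x by rewrite -[a *: x]addr0 f_lin f0 addr0.
have fN x : f (- x) = - f x by rewrite -scaleN1r fZ mulN1r.
pose N x := Re '[x, x].
pose F x := N x - 2 * Re (f x).
have NE x : N x = Re `|x| ^+ 2.
  by rewrite /N innerE [in LHS]normhE -rmorphXn.
have N_expand x y (t : R) : N (x + toC t *: y) = N x + t ^+ 2 * N y + 2 * t *
  Re '[x, y].
  rewrite /N !innerL conjc_real !(ReD, ReZ) (innerC y x) Re_conjc; ring.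
have F_expand x y (t : R) :
    F (x + toC t *: y) = F x + t ^+ 2 * N y + 2 * t * (Re '[x, y] - Re (f y)).
  rewrite /F N_expand fD fZ ReD ReZ; ring.
have Re_f x : Re (f x) <= c * Re `|x|.
  apply: le_trans (ler_norm _) (le_trans (normr_Re_le _) _).
  by have := f_bnd x; rewrite normcE_Re normhE -rmorphM lecR.
(* With r the norm of [x], the bound on [f] gives F x >= r^2 - 2 c r = (r - c)^2 - c^2. *)
have F_ge x : - c ^+ 2 <= F x.
  rewrite /F NE; have := Re_f x; set r := Re `|x|; set s := Re (f x).
  by have := sqr_ge0 (r - c); rewrite !expr2; nra.
pose m := inf (range F).
have m_inf : has_inf (range F).
  split; first by exists (F 0), 0.
  by exists (- c ^+ 2) => _ [x _ <-].
have m_le x : m <= F x by apply: ge_inf; [exact: m_inf.2|exists x].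
have /choice[u uP] n : exists x, F x < m + n.+1%:R^-1.
  have n0 : 0 < (n.+1%:R^-1 : R) by rewrite invr_gt0.
  by have [_ [x _ <-] ?] := inf_adherent n0 m_inf; exists x.
(* At the midpoint of [u p] and [u q], [F] is the mean of its two end values minus
   [N (u p - u q) / 4], and it is at least [m]. *)
have N_cauchy p q : N (u p - u q) <= 2 * (p.+1%:R^-1 + q.+1%:R^-1).
  have Fmid := F_expand (u q) (u p - u q) 2^-1.
  have Fone := F_expand (u q) (u p - u q) 1.
  rewrite scale1r subrKC in Fone.
  have := m_le (u q + toC 2^-1 *: (u p - u q)).
  have := uP p; have := uP q; rewrite Fmid.
  move: Fone; set d := Re _ - Re _; rewrite !expr2.
  move: d (F (u p)) (F (u q)) (N _) (m) (p.+1%:R^-1) (q.+1%:R^-1).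
  move=> d Fp Fq n2 m0 a b; lra.
have u_cvg : cvgn u.
  apply/cauchy_cvgP/cauchy_exP => e e0.
  have eE := ge0_realE (ltW e0); move: e0; rewrite eE ltcR;
    move: (Re e) => {eE}e e0.
  (* Once both reciprocals in [N_cauchy] are below e^2 / 4, twice their sum is below e^2. *)
  have d0 : 0 < e ^+ 2 / 4 by rewrite divr_gt0 ?exprn_gt0.
  have [p _ pP] := near_infty_natSinv_lt (PosNum d0).
  exists (u p), p => // q /= pq.
  have N0 : 0 <= Re `|u p - u q| by have := normr_ge0 (u p - u q);
    rewrite lecE => /andP[].
  rewrite -ball_normE /= normhE ltcR -ltr_sqr ?nnegrE// ?ltW//.
  rewrite -NE; apply: le_lt_trans (N_cauchy _ _) _.
  have := pP p (leqnn p); have := pP q pq; rewrite /= => hq hp.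
  rewrite -[ltRHS](@divfK _ 4) ?pnatr_eq0//; move: hp hq.
  move: (e ^+ 2 / 4) (p.+1%:R^-1) (q.+1%:R^-1) => d a b; lra.
pose v := limn u.
have Fv : F v = m.
  have FE x : F x = Re (`|x| ^+ 2 - 2 * f x).
    by rewrite /F /N innerE ReB -[X in Re (X * f x)](rmorph_nat toC) ReZ.
  have fu : ((fun n => f (u n)) : nat -> R[i]^o) @ \oo --> (f v : R[i]^o).
    apply: (@cvg_comp _ _ _ u (f : H -> R[i]^o) \oo (nbhs v)) => //.
    apply: (@bounded_continuous _ H R[i]^o f c) => // x y.
    by rewrite fD fN.
  have Fu : (fun n => F (u n)) @ \oo --> F v.
    rewrite FE (_ : (fun n => _) = fun n => Re (`|u n| ^+ 2 - 2 * f (u n)));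
      last first.
      by apply/funext => n; rewrite FE.
    apply: (@cvg_Re _ (fun n => `|u n| ^+ 2 - 2 * f (u n) : R[i]^o)).
    apply: cvgB; last by apply: cvgM => //; exact: cvg_cst.
    by apply: cvgM; apply: cvg_norm.
  apply/eqP; rewrite eq_le m_le andbT.
  have Fu' : (fun n => F (u n) - n.+1%:R^-1) @ \oo --> F v.
    rewrite -[X in _ --> X]subr0; apply: cvgB => //; exact: cvg_harmonic.
  apply: (cvgr_to_le Fu'); apply: nearW => n.
  by rewrite lerBlDr ltW.
exists v => y.
have Re_eq z : Re (f z) = Re '[z, v].
  (* Minimality of [v] is tested at a step t along [z]. For t = - d / (N z + 1) the value of [F]
     changes by - t^2 (N z + 2), so t = 0 and hence d = 0; the added 1 keeps the denominator
     positive. *)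
  have := m_le (v + toC (- (Re '[v, z] - Re (f z)) / (N z + 1)) *: z).
  rewrite F_expand Fv (innerC z v) Re_conjc; set d := _ - _.
  have Nz : 0 <= N z by exact: Re_inner_ge0.
  set t := _ / _ => h.
  have tE : d = - t * (N z + 1) by rewrite /t mulNr divfK ?gt_eqF// ?ltr_wpDl//
    opprK.
  have t2N : 0 <= t ^+ 2 * N z by rewrite mulr_ge0 ?sqr_ge0.
  have t0 : t = 0.
    apply/eqP; rewrite -sqrf_eq0 eq_le sqr_ge0 andbT.
    by move: h; rewrite tE; move: (t) (N z) (m) t2N => r q m0; rewrite !expr2;
      nra.
  by apply/eqP; rewrite eq_sym -subr_eq0 -/d tE t0 oppr0 mul0r.
(* The imaginary parts at [y] agree because the real parts at [i *: y] do. *)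
have ReiM a : Re (i * a) = - complex.Im a.
  by case: a => [b d] /=; rewrite mul0r mul1r sub0r.
apply/eqP; rewrite eq_complex Re_eq eqxx /= -eqr_opp -!ReiM -fZ -innerZl.
by rewrite Re_eq.
Qed.

(** [B x] is conjugate linear, so Riesz applied to its conjugate gives [T x]; the bound on [B] at
    [y = T x] then bounds [T]. *)
Lemma form_bop (B : H -> H -> R[i]) (c : R) :
  0 <= c -> (forall a x y z, B (a *: x + y) z = a * B x z + B y z) ->
  (forall a x y z, B z (a *: x + y) = (a^*)%C * B z x + B z y) ->
  (forall x y, `|B x y| <= toC c * `|x| * `|y|) ->
  exists T : bop H, forall x y, '[T x, y] = B x y.
Proof.
move=> c0 Bl Br Bc.
have /choice[T TP] x : exists v, forall y, '[v, y] = B x y.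
  have [| |v vP] := @riesz (fun y => (B x y)^*%C) (c * Re `|x|).
  - by move=> a y z; rewrite Br rmorphD rmorphM /= conjcK.
  - move=> y; rewrite -[_^*%C]/(Num.conj _) norm_conjC.
    by rewrite rmorphM /= -(normhE x) Bc.
  - by exists v => y; rewrite innerC -vP conjcK.
have T_lin : linear T.
  by move=> a x y; apply: inner_inj => z; rewrite !innerL !TP Bl.
have T_bnd x : `|T x| <= toC c * `|x|.
  have := Bc x (T x); rewrite -TP innerE expr2 normrM normr_id.
  have [->|Tx0] := eqVneq (T x) 0; last by rewrite ler_pM2r// normr_gt0.
  by rewrite normr0 mulr_ge0// lecR.
have T_cont : continuous T.
  apply: bounded_continuous T_bnd => x y.
  by rewrite -scaleN1r addrC T_lin scaleN1r addrC.
exists (Bop (introT (bounded_operatorP T) (conj T_lin T_cont))).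
by move=> x y; rewrite -TP.
Qed.
End Riesz.

(** * The weak* topology *)

Section SigmaWeak.
Context {R : realType} {K : hilbertSpace R}.
Implicit Types (x y : K) (u v : l2seq K) (T S : bop K) (a : R[i]).
Local Notation "''[' x , y ]" := (inner K x y).
Local Notation toC := (real_complex R).

Lemma sqr_norm_comb_le x y a :
  `|x + a *: y| ^+ 2 <= 2 * `|x| ^+ 2 + 2 * `|a| ^+ 2 * `|y| ^+ 2.
Proof.
apply: (@le_trans _ _ ((`|x| + `|a| * `|y|) ^+ 2)).
  rewrite ler_sqr ?nnegrE ?addr_ge0 ?mulr_ge0//.
  by rewrite (le_trans (ler_normD _ _))// normrZ.
rewrite -mulrA -exprMn -subr_ge0.
have : 0 <= (`|x| - `|a| * `|y|) ^+ 2.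
  by rewrite real_exprn_even_ge0// rpredB ?rpredM ?normr_real// ger0_real.
set b := `|a| * _; set c := `|x|.
suff -> : 2 * c ^+ 2 + 2 * b ^+ 2 - (c + b) ^+ 2 = (c - b) ^+ 2 by [].
by ring.
Qed.

Lemma l2_comb_subproof u v a :
  cvgn (series (fun n => `|u n + a *: v n| ^+ 2) : nat -> R[i]^o).
Proof.
apply: (@is_cvg_series_dominated R _
  (2 *: (fun n => `|u n| ^+ 2 : R[i]^o) + (2 * `|a| ^+ 2) *: (fun n => `|v n|
    ^+ 2 : R[i]^o))).
  by move=> n; rewrite ger0_norm ?exprn_ge0//; exact: sqr_norm_comb_le.
by apply: is_cvg_seriesD; apply: is_cvg_seriesZ; exact: l2P.
Qed.

Definition l2_comb u v a : l2seq K := L2seq (@l2_comb_subproof u v a).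

(** One-term sequences make the vector functionals ['[T x, y]] instances of [sigma_weak]. *)
Definition l2_single_fun x : nat -> K := fun n => if n is 0%N then x else 0.

Lemma series_single (V : normedModType R[i]) (f : nat -> V) :
  (forall n, f n.+1 = 0) -> series f @ \oo --> f 0%N.
Proof.
move=> f0; apply: cvg_near_cst; exists 1%N => // -[//|n] _.
rewrite /series /= big_nat_recl// big1 ?addr0// => k _; exact: f0.
Qed.

Lemma l2_single_subproof x :
  cvgn (series (fun n => `|l2_single_fun x n| ^+ 2) : nat -> R[i]^o).
Proof.
apply/cvg_ex; exists (`|x| ^+ 2).
apply: (@series_single R[i]^o (fun n => `|l2_single_fun x n| ^+ 2)) => n /=.
by rewrite normr0 expr0n.
Qed.

Definition l2_single x : l2seq K := L2seq (@l2_single_subproof x).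

(** Cauchy-Schwarz and s t <= s^2 + t^2 dominate the terms by a summable sequence. *)
Lemma is_cvg_sigma_weak T u v :
  cvgn (series (fun n => '[T (u n), v n]) : nat -> R[i]^o).
Proof.
have [c [c0 Tc]] := bop_bounded T.
apply: (@is_cvg_series_dominated R _
  (toC c *: ((fun n => `|u n| ^+ 2 : R[i]^o) + (fun n => `|v n| ^+ 2 :
    R[i]^o)))); last first.
  by apply: is_cvg_seriesZ; apply: is_cvg_seriesD; exact: l2P.
move=> n; apply: le_trans (cauchy_schwarz _ _) _.
apply: (@le_trans _ _ (toC c * (`|u n| * `|v n|))).
  by rewrite mulrA ler_wpM2r.
rewrite ler_wpM2l ?lecR//= -subr_ge0.
have := normr_ge0 (u n); have := normr_ge0 (v n).
set s := `|u n|; set t := `|v n| => t0 s0.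
rewrite (_ : s ^+ 2 + t ^+ 2 - s * t = (s - t) ^+ 2 + s * t); last by ring.
by rewrite addr_ge0 ?[0 <= _ ^+ 2]real_exprn_even_ge0 ?mulr_ge0 ?rpredB
  ?ger0_real.
Qed.

Lemma sigma_weak_cvg T u v :
  (series (fun n => '[T (u n), v n]) : nat -> R[i]^o) @ \oo -->
  (sigma_weak T (u, v) : R[i]^o).
Proof. exact: is_cvg_sigma_weak. Qed.

Lemma sigma_weak_eq T u v (l : R[i]^o) :
  (series (fun n => '[T (u n), v n]) : nat -> R[i]^o) @ \oo --> l ->
  sigma_weak T (u, v) = l.
Proof. exact: (cvg_lim (@norm_hausdorff _ R[i]^o)). Qed.

Lemma sigma_weak_lin u v a T S :
  sigma_weak (a *: T + S) (u, v) = a * sigma_weak T (u, v) + sigma_weak S (u,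
    v).
Proof.
apply: sigma_weak_eq.
rewrite (_ : (fun n => _) = (a *: (fun n => '[T (u n),
  v n] : R[i]^o)) + (fun n => '[S (u n), v n] : R[i]^o)); last first.
  by apply/funext => n; rewrite /= innerDl innerZl.
rewrite seriesD seriesZ; apply: cvgD; last exact: sigma_weak_cvg.
by apply: cvgZl_tmp; exact: sigma_weak_cvg.
Qed.

Lemma sigma_weak_single T x y : sigma_weak T (l2_single x,
  l2_single y) = '[T x, y].
Proof.
apply: sigma_weak_eq.
apply: (@series_single R[i]^o (fun n => '[T (l2_single x n),
  l2_single y n])) => n /=.
by rewrite bop0 linear0l.
Qed.

Lemma series_shift (f : nat -> R[i]^o) n k :
  series (fun m => f (m + n)%N) k = series f (k + n)%N - series f n.
Proof.
rewrite sub_series_geq ?leq_addl// /series /= -[in RHS](add0n n) big_addn.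
by rewrite add0n addnK; apply: eq_bigr.
Qed.

Lemma cvg_series_shift (f : nat -> R[i]^o) n (l : R[i]^o) :
  series f @ \oo --> l ->
  series (fun m => f (m + n)%N) @ \oo --> l - series f n.
Proof.
move=> fl; rewrite (_ : series _ = fun k => series f (k + n)%N - series f n).
  by apply: cvgB; [rewrite cvg_shiftn|exact: cvg_cst].
by apply/funext => k; exact: series_shift.
Qed.

Lemma l2_shift_subproof n u :
  cvgn (series (fun m => `|u (m + n)%N| ^+ 2) : nat -> R[i]^o).
Proof.
apply/cvg_ex; eexists.
apply: (@cvg_series_shift (fun m => `|u m| ^+ 2)); exact: l2P.
Qed.

(** The tail of a diagonal functional is thus a diagonal functional again, hence positive and
    normal. *)
Definition l2_shift n u : l2seq K := L2seq (@l2_shift_subproof n u).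

Lemma sigma_weak_shift T n u : sigma_weak T (l2_shift n u, l2_shift n u) =
  sigma_weak T (u, u) - \sum_(0 <= k < n) '[T (u k), u k].
Proof.
apply: sigma_weak_eq; apply: (@cvg_series_shift (fun m => '[T (u m), u m])).
exact: sigma_weak_cvg.
Qed.

Lemma sigma_weak_polar T u v : sigma_weak T (u, v) = 4^-1 *
  (sigma_weak T (l2_comb u v 1, l2_comb u v 1)
   - sigma_weak T (l2_comb u v (-1), l2_comb u v (-1))
   + 'i%C * sigma_weak T (l2_comb u v 'i%C, l2_comb u v 'i%C)
   - 'i%C * sigma_weak T (l2_comb u v (- 'i%C), l2_comb u v (- 'i%C))).
Proof.
apply: sigma_weak_eq.
pose d a : nat -> R[i]^o := fun n => '[T (l2_comb u v a n), l2_comb u v a n].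
rewrite (_ : series _ = fun n => 4^-1 * (series (d 1) n - series (d (-1)) n
    + 'i%C * series (d 'i%C) n - 'i%C * series (d (- 'i%C)) n)); last first.
  apply/funext => n; rewrite /series /= 2!big_distrr -sumrB -big_split -sumrB
    big_distrr /=.
  by apply: eq_bigr => k _; rewrite inner_polar /d /= !scale1r !scaleN1r
    !scaleNr.
have cd a := @sigma_weak_cvg T (l2_comb u v a) (l2_comb u v a).
apply: cvgM; first exact: cvg_cst.
apply: cvgB; last by apply: cvgM; [exact: cvg_cst|exact: cd].
apply: cvgD; last by apply: cvgM; [exact: cvg_cst|exact: cd].
by apply: cvgB; exact: cd.
Qed.

Lemma continuous_sigma_weak p : continuous (fun T : bop K => sigma_weak T p :
  R[i]^o).
Proof.
move=> T W TW.
have /cvg_sup/(_ p)/cvg_image h : @sigma_weak R K @ nbhs T --> sigma_weak T.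
  exact: initial_continuous.
have surj : @^~ p @` [set: l2seq K * l2seq K -> R[i]^o] = setT.
  by rewrite eqEsubset; split=> w // _; exists (cst w).
have [B TB BW] := h surj W TW.
have {}TB : nbhs T (@sigma_weak R K @^-1` B) := TB.
by apply: filterS TB => S BS; rewrite /= -BW; exists (@sigma_weak R K S).
Qed.

(** Convergence in an initial topology can be tested on the defining map, and pointwise convergence
    on the evaluations. *)
Lemma cvg_bop (F : set_system (bop K)) T : Filter F ->
  (forall p, sigma_weak S p @[S --> F] --> (sigma_weak T p : R[i]^o)) -> F -->
    T.
Proof.
move=> FF FT.
have : @sigma_weak R K @ F --> sigma_weak T.
  apply/cvg_sup => p; rewrite cvg_image; last first.
    by rewrite eqEsubset; split=> w // _; exists (cst w).
  move=> W /FT FW; exists (@^~ p @^-1` W) => //.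
  by rewrite eqEsubset; split => [j [? + <-//]|j Wj]; exists (fun _ => j).
move=> sF A [_ [[B Bop <-] BT BA]].
apply: filterS BA _; apply: sF.
by apply: open_nbhs_nbhs; split.
Qed.

End SigmaWeak.

(** * Positive normal functionals on a von Neumann algebra *)

Section PositiveFunctionals.
Context {R : realType} {H : hilbertSpace R} (M : set (bop H)).
Hypothesis vnM : vonNeumann_algebra M.
Implicit Types (x y : H) (T S : bop H) (a : R[i]) (p q : bop H -> R[i]^o).
Local Notation "''[' x , y ]" := (inner H x y).
Local Notation i := ('i%C : R[i]).
Local Notation toC := (real_complex R).

Lemma vN1 : M 1.
Proof.
by rewrite -(vN_bicommutant vnM) => S _; rewrite mul1r mulr1.
Qed.

Lemma bop_scaleAl a T S : a *: T * S = a *: (T * S).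
Proof. exact/val_inj. Qed.

Lemma bop_scaleAr a T S : T * (a *: S) = a *: (T * S).
Proof. by apply/val_inj/funext => x /=; rewrite bopZ. Qed.

Lemma vN_lin a T S : M T -> M S -> M (a *: T + S).
Proof.
rewrite -(vN_bicommutant vnM) => MT MS U MU.
by rewrite mulrDl mulrDr bop_scaleAl bop_scaleAr MT// MS.
Qed.

Lemma vN0 : M 0.
Proof.
have := vN_lin (-1) vN1 vN1.
by rewrite scaleN1r addNr.
Qed.

Lemma vNZ a T : M T -> M (a *: T).
Proof. by move=> MT; rewrite -[_ *: _]addr0; apply: vN_lin => //;
  exact: vN0. Qed.

Lemma vND T S : M T -> M S -> M (T + S).
Proof. by move=> MT MS; rewrite -[T]scale1r; exact: vN_lin. Qed.

(** Self-adjointness through the quadratic form, so that no adjoint has to be carried along. *)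
Definition hermitian_bop T := forall x, complex.Im '[T x, x] = 0.

(** The real and imaginary parts (T + S) / 2 and (T - S) / (2 i) lie in [M] because the adjoint [S]
    of [T] does; the factor 1 / (2 i) is [- i / 2]. *)
Lemma vN_hermitian_parts T : M T -> exists T1 T2,
  [/\ M T1, M T2, hermitian_bop T1, hermitian_bop T2 & T = T1 + i *: T2].
Proof.
move=> MT; have [S MS adjS] := vN_adjoint vnM MT.
exists (2^-1 *: (T + S)), ((- i / 2) *: (T + -1 *: S)).
have Sx x : '[S x, x] = ('[T x, x]^*)%C by rewrite innerC adjS.
have two0 : (2 : R[i]) != 0 by rewrite pnatr_eq0.
split.
- exact/vNZ/vND.
- by apply/vNZ/vND => //; exact: vNZ.
- move=> x.
  rewrite -[bop_fun _ x]/(2^-1 *: (T x + S x)) innerZl innerDl Sx addcJ.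
  by rewrite mulKf.
- move=> x.
  rewrite -[bop_fun _ x]/((- i / 2) *: (T x + -1 *: S x)) innerZl innerDl
    innerZl Sx mulN1r subcJ.
  rewrite -(mulrA _ 2^-1) -(mulrA 2) mulKf// mulrCA mulNr -expr2 sqr_i opprK
    mulr1.
  by [].
- have ii : i * (- i / 2) = 2^-1 by rewrite mulrA mulrN -expr2 sqr_i opprK
  mul1r.
  apply/val_inj/funext => x.
  rewrite -[RHS]/(2^-1 *: (T x + S x) + i *: ((- i / 2) *: (T x + -1 *: S x))).
  rewrite scalerA ii -scalerDr addrACA scaleN1r subrr addr0.
  by rewrite -[in RHS](scale1r (T x)) -scalerDl scalerA mulVf// scale1r.
Qed.

(** Any bound [c] of [T] will do, by Cauchy-Schwarz for ['[T x, x]]. *)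
Lemma hermitian_bop_shift T : hermitian_bop T -> exists c : R, [/\ 0 <= c,
  positive_bop (toC c *: (1 : bop H) + T) & positive_bop (toC c *: (1 : bop H)
    - T)].
Proof.
move=> hT; have [c [c0 Tc]] := bop_bounded T.
have TR x : '[T x, x] = toC (complex.Re '[T x, x]).
  by rewrite [LHS]complexE hT mulr0 addr0.
have le x : `|complex.Re '[T x, x]| <= c * complex.Re '[x, x].
  have := cauchy_schwarz (T x) x; rewrite [leLHS]normcE_Re.
  move=> h; have : toC (complex.Re `|'[T x, x]|) <= toC c * `|x| * `|x|.
    by apply: le_trans h _; rewrite ler_wpM2r.
  rewrite -mulrA -expr2 -innerE (ge0_realE (inner_ge0 x)) -rmorphM lecR.
  exact/le_trans/normr_Re_le.
exists c; split => // x.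
- rewrite -[bop_fun _ x]/(toC c *: x + T x) innerDl innerZl.
  rewrite (ge0_realE (inner_ge0 x)) TR -rmorphM -rmorphD lecR.
  by have := le x; rewrite ler_norml => /andP[h _];
    rewrite -(opprK (_ * _)) addrC subr_ge0.
- rewrite -[bop_fun _ x]/(toC c *: x - T x) innerBl innerZl.
  rewrite (ge0_realE (inner_ge0 x)) TR -rmorphM -rmorphB lecR.
  by have := le x; rewrite ler_norml => /andP[_ h]; rewrite subr_ge0.
Qed.

(** Normal states without the condition at [1]: a cone, closed under sums and nonnegative
    multiples. *)
Record normal_positive p : Prop := {
  npos_linear : linear_on M p ;
  npos_normal : normal_on M p ;
  npos_positive : forall T, M T -> positive_bop T -> 0 <= p T :> R[i] }.

Section LinearOn.
Variables (V : lmodType R[i]) (f : bop H -> V).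
Hypothesis lf : linear_on M f.

Lemma linear_on0 : f 0 = 0.
Proof.
have := lf 1 vN0 vN0; rewrite !scale1r addr0.
by move/(congr1 (fun z => z - f 0)); rewrite subrr addrK.
Qed.

Lemma linear_onZ a T : M T -> f (a *: T) = a *: f T.
Proof. by move=> MT; have := lf a MT vN0; rewrite !addr0 linear_on0 addr0. Qed.

Lemma linear_onD T S : M T -> M S -> f (T + S) = f T + f S.
Proof. by move=> MT MS; have := lf 1 MT MS; rewrite !scale1r. Qed.

Lemma linear_onB T S : M T -> M S -> f (T - S) = f T - f S.
Proof.
by move=> MT MS; have := lf (-1) MS MT; rewrite !scaleN1r addrC => ->;
  rewrite addrC.
Qed.

End LinearOn.

Lemma npos1_ge0 p : normal_positive p -> 0 <= p 1 :> R[i].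
Proof.
by move=> np; apply: (npos_positive np); [exact: vN1|exact: inner_ge0].
Qed.

(** Positivity at c 1 + T and c 1 - T makes [p T] real and bounds it on both sides. The constant is
    chosen before [p], hence uniform over all functionals. *)
Lemma npos_hermitian T : M T -> hermitian_bop T -> exists2 c : R, 0 <= c &
  forall p, normal_positive p -> exists r : R,
    p T = toC r /\ `|r| <= c * complex.Re (p 1).
Proof.
move=> MT /hermitian_bop_shift[c [c0 Tp Tm]].
have Mc : M (toC c *: (1 : bop H)) by apply: vNZ; exact: vN1.
exists c => // p np.
have pc : p (toC c *: (1 : bop H)) = toC (c * complex.Re (p 1)).
  by rewrite (linear_onZ (npos_linear np))//;
    [rewrite rmorphM /= -(ge0_realE (npos1_ge0 np))|exact: vN1].
have pp := npos_positive np (vND Mc MT) Tp.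
have MT' : M (toC c *: (1 : bop H) - T) by rewrite -scaleN1r addrC;
  exact: vN_lin.
have pm := npos_positive np MT' Tm.
move: pp pm; rewrite (linear_onD (npos_linear np))// (linear_onB (npos_linear
  np))// pc.
case: (p T) => r s; rewrite !lecE /= => /andP[/eqP s0 rp] /andP[_ rm].
exists r; split; first by rewrite add0r in s0; rewrite s0.
by rewrite ler_norml -subr_ge0 opprK addrC rp -subr_ge0.
Qed.

(** The constants of the two hermitian parts add up to one that stands in for the operator norm and
    is still independent of [p]. *)
Lemma npos_bounded T : M T -> exists2 c : R, 0 <= c &
  forall p, normal_positive p -> `|p T : R[i]| <= toC c * p 1.
Proof.
move=> /vN_hermitian_parts[T1 [T2 [M1 M2 h1 h2 ->]]].
have [c1 c10 P1] := npos_hermitian M1 h1;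
  have [c2 c20 P2] := npos_hermitian M2 h2.
exists (c1 + c2); first exact: addr_ge0.
move=> p np; have [r1 [pr1 r1c]] := P1 _ np; have [r2 [pr2 r2c]] := P2 _ np.
rewrite (linear_onD (npos_linear np))//; last exact: vNZ.
rewrite (linear_onZ (npos_linear np))// pr1 pr2 (ge0_realE (npos1_ge0 np)).
apply: le_trans (normc_le_ReIm _) _.
rewrite -rmorphM lecR /= !(mul0r, mul1r, mulr0, subr0, addr0, add0r).
by rewrite mulrDl lerD.
Qed.

Lemma npos_eq0 p T : normal_positive p -> p 1 = 0 -> M T -> p T = 0.
Proof.
move=> np p1 MT; have [c _ /(_ _ np)] := npos_bounded MT.
by rewrite p1 mulr0 normr_le0 => /eqP.
Qed.

(** On hermitian elements all four values are real, so real and imaginary parts of the identity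
    separate; hermitian elements span [M]. *)
Lemma npos_decomp_inj p1 p2 p3 p4 : normal_positive p1 -> normal_positive p2 ->
  normal_positive p3 -> normal_positive p4 ->
  (forall T, M T -> p1 T - p2 T + i * (p3 T - p4 T) = 0) ->
  {in M, p1 =1 p2} /\ {in M, p3 =1 p4}.
Proof.
move=> n1 n2 n3 n4 p0.
have herm T : M T -> hermitian_bop T -> p1 T = p2 T /\ p3 T = p4 T.
  move=> MT hT; have [c _ P] := npos_hermitian MT hT.
  have [r1 [e1 _]] := P _ n1; have [r2 [e2 _]] := P _ n2.
  have [r3 [e3 _]] := P _ n3; have [r4 [e4 _]] := P _ n4.
  have := p0 _ MT; rewrite e1 e2 e3 e4 => /eqP; rewrite eq_complex /=.
  rewrite !(mul0r, mul1r, mulr0, subr0, addr0, add0r, subrr, oppr0) !subr_eq0.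
  by move=> /andP[/eqP -> /eqP ->].
have gen p q : normal_positive p -> normal_positive q ->
    (forall T, M T -> hermitian_bop T -> p T = q T) -> {in M, p =1 q}.
  move=> np nq pq T; rewrite inE => /vN_hermitian_parts[T1 [T2 [M1 M2 h1 h2
    ->]]].
  rewrite (linear_onD (npos_linear np)) ?(linear_onD (npos_linear nq))
    ?(linear_onZ (npos_linear np)) ?(linear_onZ (npos_linear nq))//;
  try exact: vNZ.
  by rewrite !pq.
by split; apply: gen => // T MT hT; have [] := herm T MT hT.
Qed.

Lemma normal_onD p q : normal_on M p -> normal_on M q -> normal_on M (p \+ q).
Proof. by move=> np nq T; apply: cvgD; [exact: np|exact: nq]. Qed.

Lemma normal_onZ a p : normal_on M p -> normal_on M (fun T => a *: p T).
Proof. by move=> np T; apply: cvgZl_tmp; exact: np. Qed.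

Lemma npos_add p q : normal_positive p -> normal_positive q ->
  normal_positive (p \+ q).
Proof.
move=> np nq; split.
- move=> a T S MT MS /=.
  by rewrite (npos_linear np)// (npos_linear nq)// scalerDr addrACA.
- by apply: normal_onD; apply: npos_normal.
- by move=> T MT T0; apply: addr_ge0; apply: npos_positive.
Qed.

Lemma npos_scale a p : 0 <= a -> normal_positive p ->
  normal_positive (fun T => a *: p T).
Proof.
move=> a0 np; split.
- move=> b T S MT MS /=.
  by rewrite (npos_linear np)// scalerDr !scalerA mulrC.
- by apply: normal_onZ; apply: npos_normal.
- by move=> T MT T0; apply: mulr_ge0 => //; apply: npos_positive.
Qed.

Lemma sigma_weak_normal_on (u v : l2seq H) :
  normal_on M (fun T => sigma_weak T (u, v) : R[i]^o).
Proof. by apply: continuous_subspaceT; exact: continuous_sigma_weak. Qed.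

Lemma npos_sigma_weak (u : l2seq H) :
  normal_positive (fun T => sigma_weak T (u, u) : R[i]^o).
Proof.
split.
- by move=> a T S _ _; exact: sigma_weak_lin.
- exact: sigma_weak_normal_on.
- move=> T _ T0; apply: (limn_ge (@sigma_weak_cvg _ _ T u u)).
  by apply: nearW => n; apply: sumr_ge0 => k _; exact: T0.
Qed.

End PositiveFunctionals.

(** * The normal positive extension *)

Section NormalExtension.
Context {R : realType} {H K : hilbertSpace R}.
Variables (M A : set (bop H)) (D : set (bop K)) (Phi : bop H -> bop K).
Hypotheses (vnM : vonNeumann_algebra M) (vnD : vonNeumann_algebra D).
Hypotheses (A1 : A 1) (AM : A `<=` M) (PhiD : set_fun A D Phi) (Phi1 : Phi 1 =
  1).
Hypothesis uniq_ext : forall phi : bop K -> R[i]^o, normal_state D phi ->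
  exists_unique_on M (fun psi : bop H -> R[i]^o =>
    normal_state M psi /\ {in A, psi =1 phi \o Phi}).
Implicit Types (p : bop K -> R[i]^o) (g : bop H -> R[i]^o) (a : R[i]).
Implicit Types (x y : K) (u v : l2seq K).
Local Notation "''[' x , y ]" := (inner K x y).
Local Notation i := ('i%C : R[i]).
Local Notation toC := (real_complex R).

Record positive_ext p g : Prop := {
  pext_source : normal_positive D p ;
  pext_target : normal_positive M g ;
  pext_eq : forall T, A T -> g T = p (Phi T) }.

Lemma normal_state_scale (E : hilbertSpace R) (N : set (bop E)) (q : bop E ->
  R[i]^o) :
  vonNeumann_algebra N -> normal_positive N q -> q 1 != 0 ->
  normal_state N (fun T => (q 1)^-1 *: q T).
Proof.
move=> vnN nq q1; have q1' : 0 <= (q 1)^-1 :> R[i] by rewrite invr_ge0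
  (npos1_ge0 vnN nq).
have [l n pos] := npos_scale q1' nq.
by split => //; rewrite [_ *: _]mulVf.
Qed.

Lemma state_npos (E : hilbertSpace R) (N : set (bop E)) (q : bop E -> R[i]^o) :
  normal_state N q -> normal_positive N q.
Proof. by case. Qed.

Lemma pext1 p g : positive_ext p g -> g 1 = p 1.
Proof. by move=> pg; rewrite (pext_eq pg)// Phi1. Qed.

(** Division by [p 1] gives a normal state, to which the hypothesis applies. If [p 1 = 0], then [p]
    vanishes on [D] and the zero functional serves. *)
Lemma pext_exists p : normal_positive D p -> exists g, positive_ext p g.
Proof.
move=> np; have [p1|p1] := eqVneq (p 1) 0.
  exists (fun=> 0); split => //.
    split=> //; first by move=> a T S _ _; rewrite scaler0 addr0.
    by move=> T; exact: cvg_cst.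
  by move=> T AT; rewrite (npos_eq0 vnD np p1)//; exact: PhiD.
have [g [sg gA] _] := uniq_ext (normal_state_scale vnD np p1).
exists (fun T => p 1 *: g T); split => //.
  by apply: npos_scale (state_npos sg); exact: npos1_ge0 vnD _ np.
move=> T AT; rewrite gA ?inE//= scalerA.
by rewrite divff// scale1r.
Qed.

(** Since [Phi] is unital, [g 1 = p 1 = q 1 = h 1]. If this number is nonzero, dividing by it makes
    [g] and [h] normal state extensions of one state; otherwise both vanish on [M]. *)
Lemma pext_unique p q g h : positive_ext p g -> positive_ext q h ->
  {in D, p =1 q} -> {in M, g =1 h}.
Proof.
move=> pg qh pq T; rewrite inE => MT.
have D1 := vN1 vnD.
have pq1 : p 1 = q 1 by rewrite pq// inE.
have [p1|p1] := eqVneq (p 1) 0.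
  have g0 : g 1 = 0 by rewrite (pext1 pg).
  have h0 : h 1 = 0 by rewrite (pext1 qh) -pq1.
  by rewrite (npos_eq0 vnM (pext_target pg) g0)// (npos_eq0 vnM (pext_target
    qh) h0).
have [f _ fU] := uniq_ext (normal_state_scale vnD (pext_source pg) p1).
have fg : {in M, (fun S => (g 1)^-1 *: g S) =1 f}.
  apply: fU; split.
    by apply: normal_state_scale vnM (pext_target pg) _; rewrite (pext1 pg).
  by move=> S; rewrite inE => AS; rewrite /= (pext1 pg) (pext_eq pg).
have fh : {in M, (fun S => (h 1)^-1 *: h S) =1 f}.
  apply: fU; split.
    by apply: normal_state_scale vnM (pext_target qh) _;
      rewrite (pext1 qh) -pq1.
  move=> S; rewrite inE => AS;
    rewrite /= (pext1 qh) (pext_eq qh)// pq1 pq// inE.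
  exact: PhiD.
have p1' : (p 1)^-1 != 0 by rewrite invr_eq0.
apply: (scalerI p1').
have /= := fg T; rewrite (pext1 pg) => ->; last by rewrite inE.
by have /= := fh T; rewrite (pext1 qh) pq1 => ->; rewrite ?inE.
Qed.

Lemma pextD p q g h : positive_ext p g -> positive_ext q h ->
  positive_ext (fun T => p T + q T) (fun T => g T + h T).
Proof.
move=> pg qh; split.
- exact: npos_add (pext_source pg) (pext_source qh).
- exact: npos_add (pext_target pg) (pext_target qh).
- by move=> T AT; rewrite (pext_eq pg)// (pext_eq qh).
Qed.

Lemma pextZ a p g : 0 <= a -> positive_ext p g ->
  positive_ext (fun T => a *: p T) (fun T => a *: g T).
Proof.
move=> a0 pg; split.
- exact: npos_scale (pext_source pg).
- exact: npos_scale (pext_target pg).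
- by move=> T AT; rewrite (pext_eq pg).
Qed.

Lemma pext0 : positive_ext (fun=> 0) (fun=> 0).
Proof.
(* The zero pair arises as 0 times a pair known to exist. *)
have [g /(pextZ (lexx 0))] := pext_exists (npos_sigma_weak D (l2_single 0)).
have E (T : Type) (f : T -> R[i]^o) : (fun t => 0 *: f t) = fun=> 0.
  by apply/funext => t; rewrite scale0r.
by rewrite !E.
Qed.

(* The linear hull of [positive_ext], in a normal form that can be compared
   coefficientwise because positive functionals are hermitian. *)
Definition comb4 (T : Type) (p1 p2 p3 p4 : T -> R[i]^o) : T -> R[i]^o :=
  fun t => p1 t - p2 t + i * (p3 t - p4 t).

Definition normal_ext p g := exists p1 p2 p3 p4 g1 g2 g3 g4,
  [/\ [/\ positive_ext p1 g1, positive_ext p2 g2, positive_ext p3 g3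
        & positive_ext p4 g4],
      {in D, p =1 comb4 p1 p2 p3 p4} & {in M, g =1 comb4 g1 g2 g3 g4}].

Lemma positive_ext_normal p g : positive_ext p g -> normal_ext p g.
Proof.
move=> pg; have e0 := pext0.
exists p, (fun=> 0), (fun=> 0), (fun=> 0), g, (fun=> 0), (fun=> 0), (fun=> 0).
by split=> // T _; rewrite /comb4 !subr0 mulr0 addr0.
Qed.

Lemma normal_extD p q g h : normal_ext p g -> normal_ext q h ->
  normal_ext (fun T => p T + q T) (fun T => g T + h T).
Proof.
move=> [p1 [p2 [p3 [p4 [g1 [g2 [g3 [g4 [[e1 e2 e3 e4] pE gE]]]]]]]]].
move=> [q1 [q2 [q3 [q4 [h1 [h2 [h3 [h4 [[f1 f2 f3 f4] qE hE]]]]]]]]].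
do 8 eexists; split.
  by split; [exact: pextD e1 f1|exact: pextD e2 f2|exact: pextD e3 f3|exact:
    pextD e4 f4].
by move=> T DT; rewrite pE// qE// /comb4; ring.
by move=> T DT; rewrite gE// hE// /comb4; ring.
Qed.

Lemma normal_ext_congr p q g h : {in D, p =1 q} -> {in M, g =1 h} ->
  normal_ext p g -> normal_ext q h.
Proof.
move=> pq gh.
move=> [p1 [p2 [p3 [p4 [g1 [g2 [g3 [g4 [[e1 e2 e3 e4] pE gE]]]]]]]]].
exists p1, p2, p3, p4, g1, g2, g3, g4; split => // T DT.
  by rewrite -pq// pE.
by rewrite -gh// gE.
Qed.

Lemma normal_ext_i p g : normal_ext p g ->
  normal_ext (fun T => i * p T) (fun T => i * g T).
Proof.
move=> [p1 [p2 [p3 [p4 [g1 [g2 [g3 [g4 [[e1 e2 e3 e4] pE gE]]]]]]]]].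
(* i (p1 - p2 + i (p3 - p4)) = p4 - p3 + i (p1 - p2), so the parts are only permuted. *)
exists p4, p3, p1, p2, g4, g3, g1, g2; split => // T DT.
  by rewrite pE// /comb4 mulrDr [i * (i * _)]mulrA -expr2 sqr_i; ring.
by rewrite gE// /comb4 mulrDr [i * (i * _)]mulrA -expr2 sqr_i; ring.
Qed.

Lemma normal_extZ_ge0 a p g : 0 <= a -> normal_ext p g ->
  normal_ext (fun T => a * p T) (fun T => a * g T).
Proof.
move=> a0.
move=> [p1 [p2 [p3 [p4 [g1 [g2 [g3 [g4 [[e1 e2 e3 e4] pE gE]]]]]]]]].
do 8 eexists; split.
  by split; [exact: pextZ a0 e1|exact: pextZ a0 e2|exact: pextZ a0 e3|exact:
    pextZ a0 e4].
by move=> T DT; rewrite pE// /comb4 -![_ *: _]/(_ * _); ring.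
by move=> T DT; rewrite gE// /comb4 -![_ *: _]/(_ * _); ring.
Qed.

Lemma normal_extZ_real (r : R) p g : normal_ext p g ->
  normal_ext (fun T => toC r * p T) (fun T => toC r * g T).
Proof.
move=> pg; have [r0|r0] := leP 0 r.
  by apply: normal_extZ_ge0 => //; rewrite lecR.
(* A negative [r] is the nonnegative factor [- r] followed by two multiplications by [i]. *)
have : normal_ext (fun T => toC (- r) * (i * (i * p T))) (fun T => toC (- r) *
  (i * (i * g T))).
  apply: normal_extZ_ge0; first by rewrite lecR oppr_ge0 ltW.
  exact/normal_ext_i/normal_ext_i.
apply: normal_ext_congr => T _;
  rewrite [i * (i * _)]mulrA -expr2 sqr_i rmorphN /=; ring.
Qed.

Lemma normal_extZ a p g : normal_ext p g ->
  normal_ext (fun T => a * p T) (fun T => a * g T).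
Proof.
move=> pg.
have := normal_extD (normal_extZ_real (complex.Re a) pg)
  (normal_ext_i (normal_extZ_real (complex.Im a) pg)).
by apply: normal_ext_congr => T _; rewrite [in RHS](complexE a); ring.
Qed.

(** This makes the predual map well defined. The source of the difference vanishes on [D], so its
    parts coincide in pairs by [npos_decomp_inj], and so do their extensions by [pext_unique]. *)
Lemma normal_ext_unique p q g h : normal_ext p g -> normal_ext q h ->
  {in D, p =1 q} -> {in M, g =1 h}.
Proof.
move=> pg qh pq T MT; apply/eqP; rewrite -subr_eq0 -mulN1r; apply/eqP.
have [p1 [p2 [p3 [p4 [g1 [g2 [g3 [g4 [[e1 e2 e3 e4] pE gE]]]]]]]]] :=
  normal_extD pg (normal_extZ (-1) qh).
have [|p12 p34] := npos_decomp_inj vnD (pext_source e1) (pext_source e2)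
  (pext_source e3) (pext_source e4).
  by move=> S DS; have := pE S; rewrite inE => /(_ DS); rewrite /comb4 => <-;
    rewrite pq ?inE// mulN1r subrr.
rewrite gE// /comb4 (pext_unique e1 e2 p12)// (pext_unique e3 e4 p34)//.
by rewrite !subrr mulr0 addr0.
Qed.

Lemma normal_ext_linear p g : normal_ext p g -> linear_on M g.
Proof.
move=> [p1 [p2 [p3 [p4 [g1 [g2 [g3 [g4 [[e1 e2 e3 e4] pE gE]]]]]]]]] a T S MT
  MS.
rewrite !gE ?inE//; last exact: vN_lin.
rewrite /comb4 (npos_linear (pext_target e1))// (npos_linear (pext_target
  e2))//.
rewrite (npos_linear (pext_target e3))// (npos_linear (pext_target e4))//.
by rewrite -![_ *: _]/(_ * _); ring.
Qed.

(** * Vector functionals and the operators they define *)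

Lemma pext_vector x : exists g, positive_ext (fun T => '[T x, x]) g.
Proof.
apply: pext_exists.
under eq_fun do rewrite -sigma_weak_single.
exact: npos_sigma_weak.
Qed.

(** Polarization uses four vectors z of norm at most |x| + |y|. The extension of each ['[S z, z]]
    has the value |z|^2 at [1], so [npos_bounded] controls it at [T] with [c] independent of the
    vectors. *)
Lemma normal_ext_inner T : M T -> exists2 c : R, 0 <= c &
  forall x y, exists g, normal_ext (fun S => '[S x, y]) g /\
    `|g T| <= toC c * (`|x| + `|y|) ^+ 2.
Proof.
move=> MT; have [c c0 cT] := npos_bounded vnM MT; exists c => // x y.
have quarter0 : 0 <= 4^-1 :> R[i] by rewrite invr_ge0.
have Q z : `|z| <= `|x| + `|y| -> exists g,
    positive_ext (fun S => 4^-1 *: ('[S z, z] : R[i]^o)) g /\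
    `|g T| <= 4^-1 * (toC c * (`|x| + `|y|) ^+ 2).
  move=> zxy; have [g pg] := pext_vector z.
  exists (fun S => 4^-1 *: g S); split; first exact: pextZ.
  rewrite normrM ger0_norm// ler_wpM2l//.
  apply: le_trans (cT _ (pext_target pg)) _.
  rewrite ler_wpM2l ?lecR// (pext1 pg) innerE.
  by rewrite ler_sqr ?nnegrE ?addr_ge0.
have ni : `|i| = 1 by rewrite normc_def /= expr0n expr1n add0r sqrtr1.
have [g1 [e1 b1]] := Q _ (ler_normD x y).
have [g2 [e2 b2]] := Q _ (ler_normB x y).
have [|g3 [e3 b3]] := Q (x + i *: y).
  by rewrite (le_trans (ler_normD _ _))// normrZ ni mul1r.
have [|g4 [e4 b4]] := Q (x - i *: y).
  by rewrite (le_trans (ler_normB _ _))// normrZ ni mul1r.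
exists (comb4 g1 g2 g3 g4); split.
  do 8 eexists; split; first by split;
    [exact: e1|exact: e2|exact: e3|exact: e4].
    have scE (z : R[i]) (w : R[i]^o) : z *: w = z * w by [].
    by move=> S _; rewrite inner_polar /comb4 !scE; ring.
  by [].
rewrite /comb4; apply: le_trans (ler_normD _ _) _.
rewrite normrM ni mul1r.
apply: le_trans (lerD (ler_normB _ _) (ler_normB _ _)) _.
apply: le_trans (lerD (lerD b1 b2) (lerD b3 b4)) _.
by rewrite le_eqVlt; apply/orP; left; apply/eqP; field.
Qed.

(** The form ['[x, U y]] is bounded by Cauchy-Schwarz. The adjoint is used below for operators in
    the commutant of [D]. *)
Lemma bop_adjoint (U : bop K) : exists V : bop K, forall x y, '[U x, y] = '[x,
  V y].
Proof.
have [c [c0 Uc]] := bop_bounded U.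
have [| | |V VP] := @form_bop _ K (fun x y => '[x, U y]) c c0.
- by move=> a x y z; rewrite innerDl innerZl.
- by move=> a x y z; rewrite bopD bopZ innerDr innerZr.
- move=> x y; apply: le_trans (cauchy_schwarz _ _) _.
  by rewrite mulrAC mulrC ler_wpM2r// mulrC.
- by exists V => x y; rewrite innerC -VP -innerC.
Qed.

Lemma vector_ext_operator : exists Psi : bop H -> bop K, forall T, M T ->
  D (Psi T) /\
  (forall x y g, normal_ext (fun S => '[S x, y]) g -> '[Psi T x, y] = g T).
Proof.
suff /choice[Psi PsiP] : forall T, exists S, M T -> D S /\
    (forall x y g, normal_ext (fun S => '[S x, y]) g -> '[S x, y] = g T).
  by exists Psi.
(* [choice] asks for a value at every [T]; outside [M] it is 0. *)
move=> T; have [MT|] := pselect (M T); last by exists 0.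
have MT' : T \in M by rewrite inE.
have [c c0 /(_ _ _)/cid Q] := normal_ext_inner MT.
pose B x y := projT1 (Q x y) T.
(* Any extension computes [B], so its sesquilinearity can be read off from sums and multiples of
   extensions. *)
have BE x y g : normal_ext (fun S => '[S x, y]) g -> B x y = g T.
  rewrite /B; case: (Q x y) => h [e _] /= e'.
  exact: (normal_ext_unique e e').
have Bext x y : exists2 g, normal_ext (fun S => '[S x, y]) g & B x y = g T.
  rewrite /B; case: (Q x y) => h [e _] /=; by exists h.
have Bbnd x y : `|B x y| <= toC c * (`|x| + `|y|) ^+ 2.
  by rewrite /B; case: (Q x y) => h [].
have Bl a x y z : B (a *: x + y) z = a * B x z + B y z.
  have [g e ->] := Bext x z; have [h f ->] := Bext y z.
  apply: (BE _ _ (fun S => a * g S + h S)).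
  have := normal_extD (normal_extZ a e) f.
  apply: normal_ext_congr => // S _.
  by rewrite bopD bopZ innerDl innerZl.
have Br a x y z : B z (a *: x + y) = (a^*)%C * B z x + B z y.
  have [g e ->] := Bext z x; have [h f ->] := Bext z y.
  apply: (BE _ _ (fun S => (a^*)%C * g S + h S)).
  have := normal_extD (normal_extZ (a^*)%C e) f.
  by apply: normal_ext_congr => // S _; rewrite innerDr innerZr.
have B0l y : B 0 y = 0.
  by apply: (addrI (B 0 y)); rewrite -[X in X + _]mul1r -Bl scaler0 !addr0.
have B0r x : B x 0 = 0.
  by apply: (addrI (B x 0)); rewrite -[X in X + _]mul1r -(conjc1 R) -Br scaler0
    !addr0.
have BZ a b x y : B (a *: x) (b *: y) = a * ((b^*)%C * B x y).
  by rewrite -[a *: x]addr0 Bl B0l addr0 -[b *: y]addr0 Br B0r addr0.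
have normalize x : x != 0 -> exists2 z, `|z| = 1 & x = `|x| *: z.
  rewrite -normr_eq0 => x0; exists (`|x|^-1 *: x).
    by rewrite normrZ normfV normr_id mulVf.
  by rewrite scalerA divff// scale1r.
(* For unit vectors (|x| + |y|)^2 = 4; homogeneity of [B] in each argument carries this bound to all
   vectors. *)
have Bc x y : `|B x y| <= toC (4 * c) * `|x| * `|y|.
  have [->|/normalize[x1 nx ->]] := eqVneq x 0.
    by rewrite B0l normr0 normr0 mulr0 mul0r.
  have [->|/normalize[y1 ny ->]] := eqVneq y 0.
    by rewrite B0r normr0 normr0 mulr0.
  have := Bbnd x1 y1; rewrite nx ny => b1.
  rewrite BZ !normrM !normrZ nx ny !normr_id !mulr1.
  rewrite -[(_^*)%C]/(Num.conj _) norm_conjC normr_id.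
  apply: (@le_trans _ _ (`|x| * (`|y| * toC (4 * c)))); last first.
    by rewrite mulrA mulrC mulrA.
  rewrite ler_wpM2l// ler_wpM2l//; apply: le_trans b1 _.
  by rewrite le_eqVlt; apply/orP; left; apply/eqP; rewrite rmorphM rmorph_nat;
    ring.
have [|S SP] := form_bop _ Bl Br Bc; first by rewrite mulr_ge0.
exists S => _; split; last by move=> x y g /BE <-; rewrite SP.
rewrite -(vN_bicommutant vnD) => U DU.
apply/val_inj/funext => x; apply: inner_inj => y.
have [V UV] := bop_adjoint U.
rewrite -[LHS]/('[S (U x), y]) -[RHS]/('[U (S x), y]) UV !SP.
have [g e ->] := Bext x (V y).
apply: BE; apply: normal_ext_congr e => // S' DS' /=.
rewrite -UV -[U (S' x)]/((U * S') x) DU//.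
by move: DS'; rewrite inE.
Qed.

(** * Weak* continuity of the extension *)

Section ExtensionNormal.
Variable Psi : bop H -> bop K.
Hypothesis PsiE : forall T, M T -> forall x y g,
  normal_ext (fun S => '[S x, y]) g -> '[Psi T x, y] = g T.

(** Finite additivity of the predual map, for the partial sums of the diagonal functional of [u]. *)
Lemma pext_sum u n : exists g,
  normal_ext (fun S => \sum_(0 <= k < n) '[S (u k), u k]) g /\
  forall T, M T -> \sum_(0 <= k < n) '[Psi T (u k), u k] = g T.
Proof.
elim: n => [|n [g [gE gP]]].
  exists (fun=> 0); split; last by move=> T MT; rewrite big_geq.
  apply: normal_ext_congr (positive_ext_normal pext0) => // S _.
  by rewrite big_geq.
have [h hP] := pext_vector (u n).
exists (fun T => g T + h T); split.
  apply: normal_ext_congr (normal_extD gE (positive_ext_normal hP)) => // S _.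
  by rewrite big_nat_recr.
move=> T MT; rewrite big_nat_recr//= gP//; congr (_ + _).
exact: PsiE MT _ _ _ (positive_ext_normal hP).
Qed.

(* [g T] differs from the n-th partial sum of the series by the value at [T] of
   the extension of the tail, which is at most a multiple of the value of the
   tail at [1]. *)
Lemma sigma_weak_pext u g : positive_ext (fun S => sigma_weak S (u, u)) g ->
  forall T, M T -> sigma_weak (Psi T) (u, u) = g T.
Proof.
move=> ug T MT; apply: sigma_weak_eq.
have [c c0 cT] := npos_bounded vnM MT.
pose s n : R[i] := \sum_(0 <= k < n) '[(1 : bop K) (u k), u k].
have tail n : `|g T - \sum_(0 <= k < n) '[Psi T (u k), u k]| <=
    toC c * `|sigma_weak 1 (u, u) - s n|.
  have [h [hE ->]] := pext_sum u n; last by [].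
  have [t te] := pext_exists (npos_sigma_weak D (l2_shift n u)).
  (* Partial sum and tail add up to the functional of [u], so by uniqueness their extensions add up
     to [g] on [M]. *)
  have -> : g T = h T + t T.
    have := normal_extD hE (positive_ext_normal te).
    move/(normal_ext_unique (positive_ext_normal ug)); apply; rewrite ?inE//.
    by move=> S _; rewrite sigma_weak_shift subrKC.
  rewrite addrC addKr; apply: le_trans (cT _ (pext_target te)) _.
  rewrite (pext1 te) sigma_weak_shift ler_wpM2l ?lecR//.
  by rewrite -/(s n) real_ler_norm// ger0_real// -sigma_weak_shift;
    apply: (npos1_ge0 vnD (npos_sigma_weak D (l2_shift n u))).
have := @sigma_weak_cvg _ _ 1 u u => /cvgrPdist_lt s1.
apply/cvgrPdist_lt => e e0.
(* [c] may be 0, so the division is by [c + 1]. *)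
have c1 : 0 < toC (c + 1) by rewrite ltcR ltr_wpDl.
have e1 : 0 < e / toC (c + 1) by rewrite divr_gt0.
apply: filterS (s1 _ e1) => n sn; apply: le_lt_trans (tail n) _.
apply: (@le_lt_trans _ _ (toC (c + 1) * `|sigma_weak 1 (u, u) - s n|)).
  by rewrite ler_wpM2r// lecR lerDl.
by rewrite mulrC -ltr_pdivlMr.
Qed.

(** By polarization [sigma_weak (Psi S) (u, v)] is, on [M], a combination of four normal functionals
    of [S], and by [cvg_bop] such functionals decide convergence. *)
Lemma extension_normal : normal_on M Psi.
Proof.
apply/subspace_continuousP => T MT.
apply: cvg_bop => -[u v].
have npos w := npos_sigma_weak D w.
have [g1 e1] := pext_exists (npos (l2_comb u v 1)).
have [g2 e2] := pext_exists (npos (l2_comb u v (-1))).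
have [g3 e3] := pext_exists (npos (l2_comb u v i)).
have [g4 e4] := pext_exists (npos (l2_comb u v (- i))).
pose g S : R[i]^o := 4^-1 *: (g1 S + -1 *: g2 S + i *: g3 S + (- i) *: g4 S).
have PsiS S : M S -> sigma_weak (Psi S) (u, v) = g S.
  move=> MS; rewrite sigma_weak_polar (sigma_weak_pext e1)//.
  rewrite (sigma_weak_pext e2)//.
  rewrite (sigma_weak_pext e3)// (sigma_weak_pext e4)// /g -![_ *: _]/(_ * _).
  by rewrite !mulNr mul1r.
have ng : normal_on M g.
  apply: normal_onZ; repeat apply: normal_onD; try apply: normal_onZ.
  - exact: npos_normal (pext_target e1).
  - exact: npos_normal (pext_target e2).
  - exact: npos_normal (pext_target e3).
  - exact: npos_normal (pext_target e4).
have : normal_on M (fun S => sigma_weak (Psi S) (u, v) : R[i]^o).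
  apply: (@subspace_eq_continuous _ M _ g) ng => S.
  by rewrite inE => MS; rewrite /from_subspace PsiS.
by move/subspace_continuousP; apply.
Qed.

End ExtensionNormal.

(** * Existence and uniqueness of the extension *)

Lemma normal_positive_extension_exists : exists Psi : bop H -> bop K,
  normal_positive_map M D Psi /\ {in A, Psi =1 Phi}.
Proof.
have [Psi PsiP] := vector_ext_operator; exists Psi.
have PsiE T (MT : M T) := (PsiP T MT).2.
split; last first.
  move=> T; rewrite inE => AT; apply: bop_inj => x.
  have [g e] := pext_vector x.
  by rewrite (PsiE _ (AM AT) _ _ _ (positive_ext_normal e)) (pext_eq e).
split.
- by move=> T /PsiP[].
- move=> a T S MT MS; apply: bop_inj => x.
  have [g e] := pext_vector x; have {}e := positive_ext_normal e.
  rewrite -[RHS]/('[a *: Psi T x + Psi S x, x]) innerDl innerZl.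
  rewrite !(fun T MT => PsiE T MT _ _ _ e)//; last exact: vN_lin.
  by rewrite (normal_ext_linear e).
- exact: extension_normal.
- move=> T MT T0 x; have [g e] := pext_vector x.
  rewrite (PsiE _ MT _ _ _ (positive_ext_normal e)).
  exact: npos_positive (pext_target e) _ MT T0.
Qed.

Lemma normal_positive_extension_unique (Psi Psi' : bop H -> bop K) :
  normal_positive_map M D Psi -> {in A, Psi =1 Phi} ->
  normal_positive_map M D Psi' -> {in A, Psi' =1 Phi} ->
  {in M, Psi =1 Psi'}.
Proof.
have vext x (Theta : bop H -> bop K) : normal_positive_map M D Theta ->
    {in A, Theta =1 Phi} ->
    positive_ext (fun S => '[S x, x]) (fun T => '[Theta T x, x]).
  move=> nT TA; split.
  - under eq_fun do rewrite -sigma_weak_single.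
    exact: npos_sigma_weak.
  - split.
    + move=> a T S MT MS; rewrite (map_linear nT)//.
      by rewrite -[LHS]/('[a *: Theta T x + Theta S x, x]) innerDl innerZl.
    + under eq_fun do rewrite -sigma_weak_single.
      (* The vector functional is weak* continuous, being [sigma_weak] at one-term sequences, so its
         composite with [Theta] is normal. *)
      move=> T; apply: (@cvg_comp _ _ _ Theta
        (fun S => sigma_weak S (l2_single x, l2_single x) : R[i]^o)).
        exact: (map_normal nT).
      exact: continuous_sigma_weak.
    + by move=> T MT T0; exact: (map_positive nT).
  - by move=> T AT; rewrite TA// inE.
move=> nP PA nP' PA' T MT; apply: bop_inj => x.
exact: (pext_unique (vext x _ nP PA) (vext x _ nP' PA')).
Qed.

End NormalExtension.

Theorem proposition3p3 (R : realType) (H K : hilbertSpace R)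
    (M A : set (bop H)) (D : set (bop K)) (Phi : bop H -> bop K)
    (vnM : vonNeumann_algebra M) (vnD : vonNeumann_algebra D)
    (subA : unital_subalgebra A) (AM : A `<=` M) (clA : closed A)
    (PhiD : set_fun A D Phi) (linPhi : linear_on A Phi)
    (Phi1 : Phi 1 = 1) (normPhi : normal_on A Phi)
    (contrPhi : contractive_on A Phi)
    (uniq_ext : forall phi : bop K -> R[i]^o, normal_state D phi ->
       exists_unique_on M (fun psi : bop H -> R[i]^o =>
         normal_state M psi /\ {in A, psi =1 phi \o Phi})) :
  exists_unique_on M (fun Psi : bop H -> bop K =>
    normal_positive_map M D Psi /\ {in A, Psi =1 Phi}).
Proof.
have A1 := subalgebra1 subA.
have [Psi [nPsi PsiA]] := normal_positive_extension_exists vnM vnD A1 AM PhiD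
  Phi1 uniq_ext.
exists Psi => // Psi' [nPsi' Psi'A].
exact: (normal_positive_extension_unique vnM vnD A1 PhiD Phi1 uniq_ext).
Qed.
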